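(* Let $G$ be a group acting simplicially on a $\delta$-hyperbolic graph $\mathcal{G}$. (1) If the action of $G$ on $\mathcal{G}$ has the finiteness property, then $\operatorname{Spec}(G,\mathcal{G})$ consists of rational numbers. (2) If the action of $G$ on $\mathcal{G}$ has the $\kappa$-finiteness property for some positive integer $\kappa$, then $\operatorname{Spec}(G,\mathcal{G})$ consists of fractions of denominator at most $\kappa$ (each element of the spectrum has the form $p/q$ with $p,q\in\mathbb{Z}$ and $1\le q\le\kappa$).
   Context: All graphs are connected, with the edge metric $d_{\mathcal{G}}$. The asymptotic translation length of $g\in G$ is $\tau(g)=\lim_{n\to\infty} d_{\mathcal{G}}(x,g^nx)/n$ (independent of the vertex $x$); $g$ is loxodromic if $\tau(g)>0$. $\operatorname{Spec}(G,\mathcal{G})=\{\tau(g)\mid g\in G\}$. A subgraph $\mathcal{H}\subseteq\mathcal{G}$ is weakly convex if the inclusion $(\mathcal{H},d_{\mathcal{H}})\hookrightarrow(\mathcal{G},d_{\mathcal{G}})$ is an isometric embedding, where $d_{\mathcal{H}}$ is the edge metric of $\mathcal{H}$. For a loxodromic $g$, an axial subgraph of $g$ is a nonempty weakly convex, locally finite subgraph $\mathcal{A}_g$ of $\mathcal{G}$ that is preserved by $g$ and on which the induced action of $\langle g\rangle$ is cocompact. Such $\mathcal{A}_g$ is quasi-isometric to a line and so has exactly two ends; a finite set $S$ of vertices of $\mathcal{A}_g$ is end-separating if it separates the two ends of $\mathcal{A}_g$ (the two ends lie in different components of $\mathcal{A}_g- S$). The width of $\mathcal{A}_g$ is the minimum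 cardinality of an end-separating set. The action of $G$ on $\mathcal{G}$ has the finiteness property if every loxodromic element of $G$ has an axial subgraph; for an integer $\kappa\ge1$ it has the $\kappa$-finiteness property if every loxodromic element of $G$ has an axial subgraph of width at most $\kappa$. *)

(* Defs.v *)
From HB Require Import structures.
From mathcomp Require Import all_boot all_order all_algebra.
From mathcomp Require Import all_classical all_reals all_analysis.

Set Implicit Arguments.
Unset Strict Implicit.
Unset Printing Implicit Defensive.

Import Order.TTheory GRing.Theory Num.Theory.
Import numFieldNormedType.Exports.

Local Open Scope classical_set_scope.
Local Open Scope card_scope.
Local Open Scope ring_scope.

Section EdgeMetric.
Variables (V : eqType) (e : rel V).

Definition joined (n : nat) (x y : V) : Prop :=
  exists p : seq V, [/\ path e x p, last x p = y & size p = n].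

Definition reachable (x y : V) : Prop := exists n, joined n x y.

(* The length of a shortest e-path; the default value 0 is only taken between
   vertices of different components. *)
Definition gdist (x y : V) : nat :=
  xget 0%N [set n | joined n x y /\ forall m, joined m x y -> (n <= m)%N].

Definition geodesic (x y : V) (p : seq V) : Prop :=
  [/\ path e x p, last x p = y & size p = gdist x y].

End EdgeMetric.

(* Graphs are simple, nonempty and connected, not necessarily locally finite;
   the chosen point of the vertex type serves only as base vertex of [tau],
   whose value does not depend on it (lemma [tau_cvg]). *)
Record graph := Graph {
  vert :> pointedType;
  adj : rel vert;
  adj_sym : symmetric adj;
  adj_irr : irreflexive adj;
  adj_conn : forall x y, reachable adj x y }.

(* Slim triangles; the triangles have their corners at vertices. *)
Definition hyperbolic (R : realType) (delta : R) (X : graph) : Prop :=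
  forall (x y z : X) (p q r : seq X),
    geodesic (@adj X) x y p -> geodesic (@adj X) y z q ->
    geodesic (@adj X) x z r ->
  forall u : X, u \in x :: r ->
  exists2 v : X, v \in (x :: p) ++ (y :: q) &
    (gdist (@adj X) u v)%:R <= delta.

Record simplicial_action (G : groupType) (X : graph) := SimplicialAction {
  act :> G -> X -> X;
  act1 : forall x, act 1%g x = x;
  actM : forall g h x, act (g * h)%g x = act g (act h x);
  act_adj : forall g x y, adj (act g x) (act g y) = adj x y }.

Section TranslationLength.
Variables (R : realType) (G : groupType) (X : graph).
Variable a : simplicial_action G X.

Definition displacement (g : G) (x : X) (n : nat) : nat :=
  gdist (@adj X) x (a (g ^+ n)%g x).

Definition tau (g : G) : R :=
  limn (fun n => (displacement g point n)%:R / n%:R : R).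

Definition loxodromic (g : G) : Prop := 0 < tau g.

Definition Spec : set R := range tau.

End TranslationLength.

Arguments Spec R {G X} a.

(* Subgraphs are neither required to be induced nor connected. *)
Record subgraph (X : graph) := Subgraph {
  svert : set X;
  sadj : rel X;
  sadj_sym : symmetric sadj;
  sadj_vert : forall x y, sadj x y -> svert x;
  sadj_adj : forall x y, sadj x y -> adj x y }.

Section Subgraphs.
Variables (X : graph) (A : subgraph X).

Definition weakly_convex : Prop := forall x y, svert A x -> svert A y ->
  reachable (sadj A) x y /\ gdist (sadj A) x y = gdist (@adj X) x y.

Definition locally_finite : Prop :=
  forall x, svert A x -> finite_set [set y | sadj A x y].

Definition del_adj (S : set X) : rel X :=
  [rel x y | [&& sadj A x y, x \notin S & y \notin S]].

Lemma del_adj_sym S : symmetric (del_adj S).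
Proof. by move=> x y; rewrite /del_adj /= sadj_sym [(x \notin S) && _]andbC. Qed.

Lemma del_adj_vert S x y : del_adj S x y -> (svert A `\` S) x.
Proof.
by case/and3P=> /sadj_vert Ax xS _; split => // Sx; move: xS; rewrite mem_set.
Qed.

Lemma del_adj_adj S x y : del_adj S x y -> adj x y.
Proof. by case/and3P=> /sadj_adj. Qed.

Definition del (S : set X) : subgraph X :=
  Subgraph (@del_adj_sym S) (@del_adj_vert S) (@del_adj_adj S).

Definition component (C : set X) : Prop :=
  exists2 x, svert A x & C = [set y | reachable (sadj A) x y].

End Subgraphs.

Section Ends.
Variables (X : graph) (A : subgraph X).

(* An end is a point of the inverse limit, over the finite sets K of vertices,
   of the components of A - K.  Since such a choice of nonempty components is
   compatible, all the [w K] are automatically infinite.  The values of [w] on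
   infinite sets are irrelevant. *)
Definition is_end (w : set X -> set X) : Prop :=
  (forall K, finite_set K -> component (del A K) (w K)) /\
  (forall K L, finite_set K -> finite_set L -> K `<=` L -> w L `<=` w K).

(* Meant for graphs with exactly two ends, such as axial subgraphs: w1 and w2
   are then the two ends. *)
Definition end_separating (S : set X) : Prop :=
  [/\ finite_set S, S `<=` svert A &
      exists w1 w2, [/\ is_end w1, is_end w2 & w1 S <> w2 S]].

(* The minimum is characterized rather than computed, so that no default value
   is needed. *)
Definition has_width (n : nat) : Prop :=
  (exists2 S, end_separating S & S #= `I_n) /\
  (forall S, end_separating S -> `I_n #<= S).

End Ends.

Section Finiteness.
Variables (R : realType) (G : groupType) (X : graph).
Variable a : simplicial_action G X.

Definition cyclic_subgroup (g : G) : set G :=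
  [set h | exists n : nat, h = (g ^+ n)%g \/ h = (g ^- n)%g].

Definition preserves (g : G) (A : subgraph X) : Prop :=
  (forall x, svert A (a g x) <-> svert A x) /\
  (forall x y, sadj A (a g x) (a g y) = sadj A x y).

(* The vertices and edges of A are covered by the translates of a finite
   subgraph, with set of vertices F. *)
Definition cocompact_on (H : set G) (A : subgraph X) : Prop :=
  exists F : set X, [/\ finite_set F,
    forall x, svert A x -> exists2 h, H h & F (a h x) &
    forall x y, sadj A x y -> exists2 h, H h & F (a h x) /\ F (a h y)].

Definition axial (g : G) (A : subgraph X) : Prop :=
  [/\ svert A !=set0, weakly_convex A, locally_finite A, preserves g A &
      cocompact_on (cyclic_subgroup g) A].

Definition finiteness_property : Prop :=
  forall g, loxodromic R a g -> exists A, axial g A.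

Definition kappa_finiteness_property (kappa : nat) : Prop :=
  forall g, loxodromic R a g ->
  exists2 A, axial g A & exists2 w, has_width A w & (w <= kappa)%N.

End Finiteness.

Section EdgeMetricTheory.
Variables (V : eqType) (e : rel V).

Lemma gdistP (x y : V) : reachable e x y ->
  joined e (gdist e x y) x y /\
  forall m, joined e m x y -> (gdist e x y <= m)%N.
Proof.
move=> [n xyn].
have [m /asboolP mP mmin] : exists2 m, `[< joined e m x y >] &
    forall k, `[< joined e k x y >] -> (m <= k)%N.
  have ex : exists m, `[< joined e m x y >] by exists n; apply/asboolP.
  by exists (ex_minn ex); case: ex_minnP.
apply: (@xgetI _ 0%N [set n | joined e n x y /\
  forall m, joined e m x y -> (n <= m)%N] m).
by split=> // k /asboolP; exact: mmin.
Qed.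

Lemma joined_cat m n (x y z : V) :
  joined e m x y -> joined e n y z -> joined e (m + n) x z.
Proof.
move=> [p [xp lp sp]] [q [yq lq sq]]; exists (p ++ q).
by rewrite cat_path xp last_cat lp yq lq size_cat sp sq.
Qed.

Lemma joined_sym n (x y : V) : symmetric e -> joined e n x y -> joined e n y x.
Proof.
move=> es [p [xp <- <-]]; exists (rev (belast x p)).
rewrite size_rev size_belast rev_path (eq_path (e' := e)); last first.
  by move=> ? ?; rewrite es.
split=> //; case: p {xp} => //= z p; by rewrite rev_cons last_rcons.
Qed.

End EdgeMetricTheory.

Section TranslationLengthTheory.
Variables (R : realType) (G : groupType) (X : graph).
Variable a : simplicial_action G X.

Notation d := (gdist (@adj X)).

Lemma gdist_triangle (x y z : X) : (d x z <= d x y + d y z)%N.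
Proof.
have [xy _] := gdistP (adj_conn x y); have [yz _] := gdistP (adj_conn y z).
by have [_ ->] := gdistP (adj_conn x z); last exact: joined_cat xy yz.
Qed.

Lemma gdistC (x y : X) : d x y = d y x.
Proof.
have [xy xym] := gdistP (adj_conn x y); have [yx yxm] := gdistP (adj_conn y x).
by apply/eqP; rewrite eqn_leq xym ?yxm//; apply: joined_sym (@adj_sym X) _.
Qed.

Lemma gdist_act g (x y : X) : d (a g x) (a g y) = d x y.
Proof.
have le_act h u v : (d (a h u) (a h v) <= d u v)%N.
  have [[p [up lp sp]] _] := gdistP (adj_conn u v).
  have [_ ->//] := gdistP (adj_conn (a h u) (a h v)).
  exists (map (a h) p); rewrite last_map lp size_map sp path_map.
  by rewrite (eq_path (e' := @adj X)) // => ? ?; rewrite /= act_adj.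
apply/eqP; rewrite eqn_leq le_act /=.
have := le_act g^-1%g (a g x) (a g y).
by rewrite -!actM mulVg !act1.
Qed.

Lemma displacementD g (x : X) m n :
  (displacement a g x (m + n) <= displacement a g x m + displacement a g x n)%N.
Proof.
apply: leq_trans (gdist_triangle _ (a (g ^+ m)%g x) _) _.
by rewrite leq_add2l expgnDr actM gdist_act.
Qed.

Lemma displacement_base g (x y : X) n :
  (displacement a g x n <= displacement a g y n + 2 * d x y)%N.
Proof.
apply: leq_trans (gdist_triangle _ y _) _.
rewrite mul2n -addnn addnCA leq_add2l.
apply: leq_trans (gdist_triangle _ (a (g ^+ n)%g y) _) _.
by rewrite leq_add2l gdist_act gdistC.
Qed.

(* Fekete's lemma *)
Lemma cvg_subadditive (u : nat -> nat) :
  (forall m n, (u (m + n) <= u m + u n)%N) ->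
  cvgn (fun n => (u n)%:R / n%:R : R).
Proof.
move=> uD; pose v n : R := (u n)%:R / n%:R.
have uM k n r : (u (k * n + r) <= k * u n + u r)%N.
  elim: k => [|k IH]; first by rewrite !mul0n.
  by rewrite !mulSn -addnA (leq_trans (uD _ _)) // -addnA leq_add2l.
pose E := [set v n.+1 | n in [set: nat]].
have E0 : E !=set0 by exists (v 1%N), 0%N.
have lbE : lbound E 0 by move=> _ [n _ <-]; rewrite divr_ge0.
have hE : has_inf E by split=> //; exists 0.
apply/cvg_ex; exists (inf E).
apply/cvgrPdist_le => eps eps0.
have [_ [m _ <-] vm] : exists2 t, E t & t < inf E + eps / 2.
  by apply: inf_adherent; rewrite ?divr_gt0.
pose B : R := (m.+1 * u 1 + u 0)%N%:R.
near=> n.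
have n0 : (0 < n)%N by near: n; exists 1%N.
have nR : 0 < n%:R :> R by rewrite ltr0n.
have le1 : inf E <= v n.
  by apply: ge_inf; [exists 0|exists n.-1; rewrite ?prednK].
have le2 : v n <= v m.+1 + B / n%:R.
  rewrite /v ler_pdivrMr // mulrDl divfK ?gt_eqF //.
  have h : (u n <= (n %/ m.+1) * u m.+1 + (m.+1 * u 1 + u 0))%N.
    rewrite {1}(divn_eq n m.+1) (leq_trans (uM _ _ _)) // leq_add2l.
    have := uM (n %% m.+1)%N 1%N 0%N; rewrite muln1 addn0 => /leq_trans; apply.
    by rewrite leq_add2r leq_mul2r ltnW ?orbT // ltn_mod.
  apply: (@le_trans _ _ ((n %/ m.+1) * u m.+1 + (m.+1 * u 1 + u 0))%N%:R).
    by rewrite ler_nat.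
  rewrite natrD lerD2r mulrAC ler_pdivlMr ?ltr0n // -!natrM ler_nat mulnAC.
  by rewrite [leqLHS]mulnC leq_mul2l leq_divM orbT.
have le3 : B / n%:R <= eps / 2.
  rewrite ler_pdivrMr // -ler_pdivrMl ?divr_gt0 //.
  near: n; exact: nbhs_infty_ger.
rewrite distrC ger0_norm ?subr_ge0 // lerBlDl.
apply: le_trans le2 _; rewrite [eps]splitr addrA lerD //.
exact: ltW.
Unshelve. all: by end_near. Qed.

Lemma tau_cvg g (x : X) :
  (fun n => (displacement a g x n)%:R / n%:R : R) @ \oo --> tau R a g.
Proof.
pose v y n : R := (displacement a g y n)%:R / n%:R.
have cv : v point @ \oo --> tau R a g.
  exact: (cvg_subadditive (displacementD g point)).
pose c : R := (2 * d x point)%N%:R.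
have c0 : (fun n => c / n%:R) @ \oo --> (0 : R).
  apply/cvgr0Pnorm_le => eps eps0; near=> n.
  have n0 : (0 < n)%N by near: n; exists 1%N.
  rewrite ger0_norm ?divr_ge0 // ler_pdivrMr ?ltr0n // -ler_pdivrMl //.
  near: n; exact: nbhs_infty_ger.
apply: (@squeeze_cvgr _ _ _ _ (fun n => v point n - c / n%:R)
  (fun n => v point n + c / n%:R)).
- near=> n; rewrite /v -mulrBl -mulrDl !ler_wpM2r ?invr_ge0 //=.
    by rewrite -natrD ler_nat displacement_base.
  by rewrite lerBlDr -natrD ler_nat /c gdistC displacement_base.
- by rewrite -[X in _ --> X]subr0; exact: cvgB.
- by rewrite -[X in _ --> X]addr0; exact: cvgD.
Unshelve. all: by end_near. Qed.

End TranslationLengthTheory.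

(* Main.v *)
Require Import Defs.
From HB Require Import structures.
From mathcomp Require Import all_boot all_order all_algebra.
From mathcomp Require Import all_classical all_reals all_analysis.
From mathcomp Require Import zify.

(* Since tau(g) > 0, the powers of g act freely on an axial subgraph A, so A / <g>
   is a finite graph whose closed walks carry an integer voltage, and tau(g) is
   the least ratio length / voltage over closed walks of positive voltage.
   Cutting a closed walk at a repeated vertex shows that the minimum is attained
   by a simple closed walk, hence tau(g) = p / q with p its length and q its
   voltage.  Its lift to A is a g^q-invariant line whose translates by
   1, g, ..., g^(q-1) are pairwise disjoint because the walk is simple.  As A lies
   in a bounded neighbourhood of each of these lines, every end-separating set
   meets all of them, and so q is at most the width of A. *)

Set Implicit Arguments.
Unset Strict Implicit.
Unset Printing Implicit Defensive.

Import Order.TTheory GRing.Theory Num.Theory.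
Local Open Scope classical_set_scope.
Local Open Scope card_scope.
Local Open Scope ring_scope.

(** * Walks and reachability *)

Section Joined.
Variables (V : eqType) (e : rel V).

Lemma reachable_refl x : reachable e x x.
Proof. by exists 0%N, [::]. Qed.

Lemma reachable_trans x y z : reachable e x y -> reachable e y z -> reachable e x z.
Proof. by move=> [m xy] [n yz]; exists (m + n)%N; exact: joined_cat xy yz. Qed.

Lemma reachable_sym x y : symmetric e -> reachable e x y -> reachable e y x.
Proof. by move=> es [n xy]; exists n; exact: joined_sym. Qed.

Lemma joined_nth x p i j : path e x p -> (i <= j <= size p)%N ->
  joined e (j - i) (nth x (x :: p) i) (nth x (x :: p) j).
Proof.
move=> xp /andP[/subnKC <-]; move: (j - i)%N => k; rewrite addKn.
elim: k => [|k IH]; first by rewrite addn0; exists [::].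
rewrite addnS => ikp; rewrite -addn1; apply: joined_cat (IH (ltnW ikp)) _.
exists [:: nth x p (i + k)]; split=> //=; rewrite andbT.
by have /pathP := xp; apply.
Qed.

Lemma joined_mem x p u : path e x p -> u \in x :: p ->
  exists2 n, (n <= size p)%N & joined e n x u.
Proof.
move=> xp uxp; have := uxp; rewrite -index_mem /= ltnS => ip.
exists (index u (x :: p)) => //.
have := @joined_nth x p 0 (index u (x :: p)) xp ip.
by rewrite subn0 nth_index.
Qed.

Lemma reachable_mem x p u : path e x p -> u \in x :: p -> reachable e x u.
Proof. by move=> xp /(joined_mem xp)[n _ xu]; exists n. Qed.

End Joined.

(** * The powers of [g] as an action of the integers *)

Section IntegerAction.
Variables (G : groupType) (X : graph) (a : simplicial_action G X) (g : G).

Definition zact (k : int) : X -> X :=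
  match k with
  | Posz n => a (g ^+ n)%g
  | Negz n => a (g ^- n.+1)%g
  end.

Lemma zact0 x : zact 0 x = x.
Proof. exact: act1. Qed.

Lemma zactS k x : zact (k + 1) x = a g (zact k x).
Proof.
case: k => [n|[|n]].
- by rewrite -PoszD addn1 /= expgS actM.
- by rewrite /= act1 expg1 -actM mulgV act1.
- have -> : (Negz n.+1 + 1)%R = Negz n by lia.
  by rewrite /zact -!expVgn (expgS _ n.+1) -actM mulVKg.
Qed.

Lemma zactD k l x : zact (k + l) x = zact k (zact l x).
Proof.
(* Injectivity of [g] reduces the descending step of the induction to [zactS]. *)
have inj_g : injective (a g).
  by apply: can_inj (a g^-1%g) _ => y; rewrite -actM mulVg act1.
elim/int_ind: k => [|n IH|n IH]; first by rewrite add0r zact0.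
  by rewrite -addn1 PoszD addrAC !zactS IH.
by apply: inj_g; rewrite -!zactS -addrA (addrC l) addrA -addn1 PoszD opprD subrK.
Qed.

Lemma zactK k : cancel (zact k) (zact (- k)).
Proof. by move=> x; rewrite -zactD addNr zact0. Qed.

Lemma zactKV k : cancel (zact (- k)) (zact k).
Proof. by move=> x; rewrite -zactD subrr zact0. Qed.

Lemma cyclic_subgroup_zact h : cyclic_subgroup g h -> exists k, a h =1 zact k.
Proof.
case=> -[|n] [->|->].
- by exists 0.
- by exists 0 => x; rewrite /= invg1.
- by exists n.+1.
- by exists (Negz n).
Qed.

(** Orbits serve as the vertices of the quotient by [g]. *)
Definition orb (x : X) : set X := [set y | exists k, y = zact k x].

Lemma orb_zact k x : orb (zact k x) = orb x.
Proof.
apply/seteqP; split=> y [l ->]; first by exists (l + k); rewrite zactD.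
by exists (l - k); rewrite -zactD subrK.
Qed.

Lemma orb_inj x y : orb x = orb y -> exists k, y = zact k x.
Proof. by move=> xy; have : orb y y by [exists 0; rewrite zact0]; rewrite -xy. Qed.

Section Preserved.
Variable A : subgraph X.
Hypothesis gA : preserves a g A.

Lemma svert_zact k x : svert A (zact k x) <-> svert A x.
Proof.
case: gA => vA _.
elim/int_ind: k => [|n IH|n IH]; first by rewrite zact0.
  by rewrite -addn1 PoszD zactS vA.
by rewrite -IH -vA -zactS -addn1 PoszD opprD subrK.
Qed.

Lemma sadj_zact k x y : sadj A (zact k x) (zact k y) = sadj A x y.
Proof.
case: gA => _ eA.
elim/int_ind: k => [|n IH|n IH]; first by rewrite !zact0.
  by rewrite -addn1 PoszD !zactS eA.
by rewrite -IH -eA -!zactS -addn1 PoszD opprD subrK.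
Qed.

Lemma path_zact k x p :
  path (sadj A) (zact k x) (map (zact k) p) = path (sadj A) x p.
Proof. by rewrite path_map; apply: eq_path => u v /=; rewrite sadj_zact. Qed.

Lemma joined_zact k n x y :
  joined (sadj A) n x y -> joined (sadj A) n (zact k x) (zact k y).
Proof.
move=> [p [xp <- <-]]; exists (map (zact k) p).
by rewrite path_zact last_map size_map.
Qed.

End Preserved.

End IntegerAction.

(** * Walks in subgraphs and in their complements *)

Lemma path_svert (X : graph) (A : subgraph X) x p :
  svert A x -> path (sadj A) x p -> {in x :: p, forall u, svert A u}.
Proof.
elim: p x => [|y p IH] x Ax /=; first by move=> _ u; rewrite inE => /eqP ->.
case/andP=> xy yp u; rewrite inE => /predU1P[-> //|].
by apply: IH => //; apply: (@sadj_vert _ A y x); rewrite sadj_sym.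
Qed.

Lemma path_del (X : graph) (A : subgraph X) (S : set X) x p :
  path (sadj A) x p -> {in x :: p, forall u, ~ S u} -> path (sadj (del A S)) x p.
Proof.
elim: p x => [//|y p IH] x /= /andP[xy yp] nS.
rewrite IH //; last by move=> u yu; apply: nS; rewrite inE yu orbT.
rewrite andbT /del_adj /= xy /=; apply/andP; split; apply/negP => /set_mem.
  by apply: nS; rewrite mem_head.
by apply: nS; rewrite !inE eqxx orbT.
Qed.

(** Each further step of a walk takes a finite union of finite sets of neighbours. Bounded
    neighbourhoods of a finite [S] are thus finite, so an end can be evaluated on them. *)
Lemma finite_sphere (X : graph) (A : subgraph X) (S : set X) n :
  locally_finite A -> finite_set S ->
  finite_set [set y | exists2 x, S x & joined (sadj A) n x y].
Proof.
move=> lfA fS; elim: n => [|n IH].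
  by apply: sub_finite_set fS => y [x Sx [p [_ <- /size0nil ->]]].
have fadj x : finite_set [set y | sadj A x y].
  case: (pselect (svert A x)) => [/lfA//|nAx].
  by apply: sub_finite_set (finite_set0 _) => y /= /sadj_vert.
apply: sub_finite_set (bigcup_finite IH (fun x _ => fadj x)).
move=> y [x Sx [p]]; case/lastP: p => [[]//|p u].
rewrite rcons_path last_rcons size_rcons => -[/andP[xp pu] <- [sp]].
by exists (last x p) => //; exists x => //; exists p.
Qed.

(** * Bounds on the translation length *)

Section TranslationLengthBounds.
Variables (R : realType) (G : groupType) (X : graph).
Variables (a : simplicial_action G X) (g : G).
Notation tau := (tau R a g).

Lemma le_tau (x : X) (c : R) :
  (forall n, c * n%:R <= (displacement a g x n)%:R) -> c <= tau.
Proof.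
move=> cx; apply: (@cvgr_to_ge _ _ _ _ _ _ _ (@tau_cvg R G X a g x)); near=> n.
have n0 : (0 < n)%N by near: n; exists 1%N.
by rewrite ler_pdivlMr ?ltr0n.
Unshelve. all: by end_near. Qed.

Lemma tau_ge0 : 0 <= tau.
Proof. by apply: (@le_tau point) => n; rewrite mul0r. Qed.

(** By subadditivity the displacement of [g ^+ (q * m)] is at most [m * l], and the limit defining
    [tau] may be tested along multiples of [q]. *)
Lemma tau_le (x : X) q l :
  joined (@adj X) l x (a (g ^+ q)%g x) -> tau * q%:R <= l%:R.
Proof.
move=> xl; case: (posnP q) => [->|q0]; first by rewrite mulr0.
have disp m : (displacement a g x (q * m) <= m * l)%N.
  elim: m => [|m IH].
    rewrite muln0; have [_ ->//] := gdistP (adj_conn x (a (g ^+ 0)%g x)).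
    by exists [::]; rewrite act1.
  rewrite mulnS mulSn (leq_trans (displacementD _ _ _ _ _)) // leq_add //.
  by have [_ ->] := gdistP (adj_conn x (a (g ^+ q)%g x)).
rewrite -ler_pdivlMr ?ltr0n // leNgt; apply/negP => lt_tau.
have [N _ /(_ (q * N.+1)%N)] := cvgr_gt _ (@tau_cvg R G X a g x) _ lt_tau.
have NqN : (N <= q * N.+1)%N by rewrite (leq_trans (leqnSn N)) ?leq_pmull.
move=> /(_ NqN).
rewrite ltr_pdivlMr ?ltr0n ?muln_gt0 ?q0 // natrM mulrA divfK ?pnatr_eq0 -?lt0n //.
by rewrite -natrM ltr_nat mulnC ltnNge disp.
Qed.

(** A fixed vertex is a walk of length 0 from [x] to its translate, which [tau_le] forbids for
    [k > 0]; a negative [k] is reduced to its opposite. *)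
Lemma zact_free k x : loxodromic R a g -> zact a g k x = x -> k = 0.
Proof.
move=> lox; have free n : zact a g (Posz n) x = x -> n = 0%N.
  move=> nx; have : joined (@adj X) 0 x (a (g ^+ n)%g x).
    by exists [::]; rewrite -[a _ x]/(zact a g n x) nx.
  by move=> /tau_le; rewrite pmulr_rle0 // lern0 => /eqP.
case: k => [n /free -> //|n nx].
have := congr1 (zact a g n.+1) nx.
by rewrite -[Negz n]/(- n.+1%:Z) zactKV => /esym/free.
Qed.

End TranslationLengthBounds.

(** Among finitely many ratios, those above [t] have a minimum, which is itself above [t]. *)
Lemma ratio_gap (R : realFieldType) (t : R) (s : seq (nat * nat)) :
  exists2 c, t < c & {in s, forall lq, t * lq.2%:R < lq.1%:R ->
    c * lq.2%:R <= lq.1%:R}.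
Proof.
elim: s => [|[l q] s [c tc cs]]; first by exists (t + 1); rewrite ?ltrDl.
have le_cs c' : c' <= c -> {in s, forall lq, t * lq.2%:R < lq.1%:R ->
    c' * lq.2%:R <= lq.1%:R}.
  by move=> le_c lq lqs /(cs _ lqs); apply: le_trans; rewrite ler_wpM2r.
case: (posnP q) => [->|q0].
  exists c => // -[l' q']; rewrite inE => /predU1P[[-> ->] _|/cs//].
  by rewrite mulr0.
have [lt_l|le_l] := ltP (t * q%:R) l%:R.
  exists (Num.min c (l%:R / q%:R)).
    by rewrite lt_min tc ltr_pdivlMr ?ltr0n.
  move=> lq; rewrite inE => /predU1P[-> _|]; last by apply: le_cs; rewrite ge_min lexx.
  by rewrite -ler_pdivlMr ?ltr0n //= ge_min lexx orbT.
exists c => // lq; rewrite inE => /predU1P[-> /=|/cs//].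
by rewrite ltNge le_l.
Qed.

(** * Closed walks in the quotient of an axial subgraph *)

Section AxialSubgraph.
Variables (R : realType) (G : groupType) (X : graph).
Variables (a : simplicial_action G X) (g : G) (A : subgraph X).
Hypotheses (lox : loxodromic R a g) (axA : axial a g A).
Notation tau := (tau R a g).
Notation z := (zact a g).
Notation orb := (orb a g).

(* The lift to A of a simple closed walk of the quotient of A by g, of voltage q. *)
Definition simple_cycle x p q :=
  [/\ svert A x, path (sadj A) x p, last x p = z (Posz q) x &
      uniq (map orb (belast x p))].

Let gA : preserves a g A. Proof. by case: axA. Qed.

Lemma orbit_reps : exists s : seq X, forall x, svert A x ->
  exists2 k, svert A (z k x) & z k x \in s.
Proof.
case: axA => _ _ _ _ [F [/finite_seqP[s ->] Fs _]]; exists s => x Ax.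
have [h gh hx] := Fs x Ax; have [k hk] := cyclic_subgroup_zact a gh.
by exists k; [apply/svert_zact | rewrite -hk].
Qed.

(** The steps of a simple cycle start in distinct orbits, and cocompactness leaves only finitely
    many orbits. *)
Lemma simple_cycle_bounded :
  exists M, forall x p q, simple_cycle x p q -> (size p <= M)%N.
Proof.
have [s sP] := orbit_reps; exists (size s) => x p q [Ax xp _ up].
rewrite -(size_belast x) -(size_map orb) -(size_map orb s) uniq_leq_size //.
move=> _ /mapP[y yp ->]; have [|k _ ks] := sP y.
  by apply: path_svert xp _ _ => //; rewrite lastI mem_rcons inE yp orbT.
by rewrite -(orb_zact a g k y) map_f.
Qed.

Lemma joined_adj n x y : joined (sadj A) n x y -> joined (@adj X) n x y.
Proof.
move=> [p [xp <- <-]]; exists p; split=> //.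
by apply: sub_path xp => u v; apply: sadj_adj.
Qed.

Lemma simple_cycle_ge x p q : simple_cycle x p q -> tau * q%:R <= (size p)%:R.
Proof.
by move=> [_ xp lp _]; apply: (@tau_le _ _ _ _ _ x); apply: joined_adj; exists p.
Qed.

(* A repeated vertex of the quotient splits the walk into two shorter ones whose
   voltages add up to k. *)
Lemma walk_ge (c : R) : 0 <= c ->
  (forall x p q, simple_cycle x p q -> c * q%:R <= (size p)%:R) ->
  forall n x k, svert A x -> joined (sadj A) n x (z k x) -> c * k%:~R <= n%:R.
Proof.
move=> c0 cP; elim/ltn_ind=> n IH x k Ax [p [xp lp sp]].
have [up|nup] := boolP (uniq (map orb (belast x p))).
  (* Without repetition the walk is a simple cycle if [k] is nonnegative; otherwise the left side is
     at most 0. *)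
  case: k => [q|q] in lp *; first by rewrite -sp; apply: (cP x p q); split.
  by apply: le_trans (ler0n _ _); rewrite mulr_ge0_le0 ?lerz0.
have /(uniqPn (orb x))[i [j [lt_ij]]] := nup.
rewrite size_map size_belast sp => lt_jn.
have nthE m : (m < n)%N -> nth (orb x) (map orb (belast x p)) m = orb (nth x (x :: p) m).
  move=> lt_m; rewrite (nth_map x) ?size_belast ?sp //; congr (orb _).
  by rewrite lastI nth_rcons size_belast sp lt_m.
rewrite !nthE ?(ltn_trans lt_ij) // => /orb_inj[m vm].
have lt_in := ltn_trans lt_ij lt_jn.
have walk_nth i' j' : (i' <= j' <= n)%N -> joined (sadj A) (j' - i')
    (nth x (x :: p) i') (nth x (x :: p) j').
  by rewrite -sp; exact: joined_nth.
have /walk_nth Jij : (i <= j <= n)%N by rewrite (ltnW lt_ij) (ltnW lt_jn).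
have /walk_nth : (0 <= i <= n)%N by rewrite (ltnW lt_in).
rewrite subn0 /= => J0i.
have /walk_nth : (j <= n <= n)%N by rewrite leqnn (ltnW lt_jn).
have -> : nth x (x :: p) n = z k x by rewrite -sp -last_nth.
(* The part between the repetitions has voltage [m]. Translated by [- m], the final part starts
   where the initial part ends, which closes up a walk of voltage [k - m]. *)
rewrite vm => /(joined_zact gA (- m)).
rewrite zactK -zactD => Jjn.
have Avi : svert A (nth x (x :: p) i).
  by apply: path_svert xp _ _ => //; rewrite mem_nth //= sp ltnS ltnW.
rewrite vm in Jij.
have lt_d : (j - i < n)%N by lia.
have lt_d' : (i + (n - j) < n)%N by lia.
have le1 := IH _ lt_d _ _ Avi Jij.
have le2 := IH _ lt_d' _ _ Ax (joined_cat J0i Jjn).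
have := lerD le1 le2; rewrite -mulrDr -intrD -natrD addrA subrr add0r.
by rewrite (_ : (j - i + (i + (n - j)) = n)%N) //; lia.
Qed.

(** If no simple cycle attained [tau], all their ratios would be at least some [c > tau]. By
    [walk_ge] this bound would pass to all walks from [x] to its translates, and then to [tau]
    itself. *)
Lemma minimal_cycle : exists x p q,
  [/\ simple_cycle x p q, (0 < q)%N & (size p)%:R = tau * q%:R].
Proof.
apply: contrapT => noC; have [M MP] := simple_cycle_bounded.
(* The length bound M bounds the voltages as well, as tau q <= size p; so only
   finitely many ratios occur. *)
pose N := (Num.truncn (M%:R / tau)).+1.
have [c tc cP] := ratio_gap tau [seq (l, q) | l <- iota 0 M.+1, q <- iota 0 N].
suff : c <= tau by rewrite leNgt tc.
have [[x Ax] wc _ _ _] := axA.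
have c0 : 0 <= c by apply: le_trans (ltW tc); exact: tau_ge0.
apply: (@le_tau _ _ _ _ _ x) => n.
(* Weak convexity realizes the displacement by a walk inside [A]. *)
have [r e] : reachable (sadj A) x (z n x) /\
    gdist (sadj A) x (z n x) = displacement a g x n.
  by apply: wc => //; apply/svert_zact.
have [xn _] := gdistP r; rewrite e in xn.
apply: walk_ge Ax xn => // {e r x wc n} x p q C.
case: (posnP q) => [->|q0]; first by rewrite mulr0.
have le_qM : tau * q%:R <= M%:R.
  by apply: le_trans (simple_cycle_ge C) _; rewrite ler_nat; apply: MP C.
apply: (cP (size p, q)).
  apply: (@allpairs_f _ _ _ pair).
    by rewrite mem_iota /= ltnS; apply: MP C.
  rewrite mem_iota /= add0n -(@ltr_nat R).
  by apply: le_lt_trans (truncnS_gt _); rewrite ler_pdivlMr // mulrC.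
rewrite lt_neqAle (simple_cycle_ge C) andbT; apply/eqP => e.
by apply: noC; exists x, p, q.
Qed.

(** * The disjoint lines above a simple cycle *)

Section Lines.
Variables (x : X) (p : seq X) (q : nat).
Hypotheses (C : simple_cycle x p q) (q0 : (0 < q)%N).

(** The translate by [z i] of the lifted cycle. One period is [belast x p], since [last x p] already
    starts the next one. *)
Definition line (i : int) : set X :=
  [set y | exists k : int, exists2 u, u \in belast x p & y = z (i + k * q) u].

Let Ax : svert A x. Proof. by case: C. Qed.

Lemma line_mem i (k : int) u : u \in x :: p -> line i (z (i + k * q) u).
Proof.
case: C => _ _ lp _; rewrite lastI mem_rcons inE => /predU1P[->|ub]; last first.
  by exists k, u.
exists (k + 1), x; last by rewrite lp -zactD mulrDl mul1r addrA.
(* An empty [p] would make [x] a fixed point of [z q], against freeness. *)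
case: p lp => [lp|v r _]; last by rewrite mem_head.
by have := zact_free lox (esym lp : z q x = x); lia.
Qed.

(** A common vertex comes from [u] and [v] in one orbit. Simplicity gives [u = v], freeness equates
    the two exponents, and so [i] and [j] agree modulo [q]. *)
Lemma line_disjoint i j y : (i < q)%N -> (j < q)%N ->
  line (Posz i) y -> line (Posz j) y -> i = j.
Proof.
case: C => _ _ _ up lt_iq lt_jq [k [u ub yu]] [l [v vb yv]].
have eq_orb : orb u = orb v.
  by rewrite -(orb_zact a g (Posz i + k * q) u) -yu yv orb_zact.
have uv : u = v.
  rewrite -(nth_index x ub) -(nth_index x vb); congr nth; apply/eqP.
  rewrite -(nth_uniq (orb x) _ _ up) ?size_map ?index_mem //.
  by rewrite !(nth_map x) ?index_mem // !nth_index // eq_orb.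
have : (Posz i + k * q) - (Posz j + l * q) = 0.
  apply: (zact_free lox (x := u)).
  by rewrite addrC zactD -yu yv uv zactK.
move=> e; have {}e : Posz i - Posz j = (l - k) * q by lia.
have : l - k = 0 by nia.
by move=> lk; rewrite lk in e; lia.
Qed.

(** Each translate of [p] runs through one period and ends where the next one starts. *)
Lemma line_connected S i : (forall y, line i y -> ~ S y) ->
  forall y, line i y -> reachable (sadj (del A S)) (z i x) y.
Proof.
move=> iS; have [_ xp lp _] := C.
have block (k : int) u : u \in x :: p ->
    reachable (sadj (del A S)) (z (i + k * q) x) (z (i + k * q) u).
  move=> ux; apply: (@reachable_mem _ _ _ (map (z (i + k * q)) p)).
    apply: path_del; first by rewrite path_zact.
    by move=> _ /(@mapP _ _ _ (x :: p))[v vx ->]; apply/iS/line_mem.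
  exact: (map_f (z (i + k * q)) ux).
have step (k : int) : reachable (sadj (del A S)) (z (i + k * q) x) (z (i + (k + 1) * q) x).
  have := block k (last x p) (mem_last _ _).
  by rewrite lp -zactD mulrDl mul1r addrA.
have base (k : int) : reachable (sadj (del A S)) (z i x) (z (i + k * q) x).
  elim/int_ind: k => [|n IH|n IH].
  - by rewrite mul0r addr0; exact: reachable_refl.
  - by apply: reachable_trans IH _; rewrite -addn1 PoszD.
  - apply: reachable_trans IH _; apply/reachable_sym; first exact: sadj_sym.
    have := step (- n.+1%:Z); rewrite (_ : - n.+1%:Z + 1 = - n%:Z) //; lia.
move=> _ [k [u ub ->]]; apply: reachable_trans (base k) (block k u _).
by rewrite lastI mem_rcons inE ub orbT.
Qed.

Lemma line_cobounded : exists D, forall i y, svert A y ->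
  exists2 u, line i u & exists2 n, (n <= D)%N & joined (sadj A) n y u.
Proof.
have [s sP] := orbit_reps.
(* A translation preserving [line i] up to the shift by [i] brings [y] to some [z r f] with [f] a
   representative and [r < q]: finitely many distances to [x] remain. *)
exists (\max_(f <- s) \max_(r < q) gdist (sadj A) (z (r : nat) f) x) => i y Ay.
have [k Af fs] := sP y Ay.
pose m := ((- k - i) %/ q)%Z; pose r := ((- k - i) %% q)%Z.
have e : - k = i + m * q + r by rewrite -addrA -divz_eq addrC subrK.
have q0Z : 0 < q%:Z by [].
have [r' rE] : exists r' : nat, r = r'.
  by have := modz_ge0 (- k - i) (lt0r_neq0 q0Z); rewrite -/r; case: (r) => // r' _; exists r'.
have lt_rq : (r' < q)%N by have := ltz_pmod (- k - i) q0Z; rewrite -/r rE.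
exists (z (i + m * q) x); first by apply: line_mem; rewrite mem_head.
exists (gdist (sadj A) (z r' (z k y)) x).
  apply: leq_trans (leq_bigmax_seq (z k y) fs isT).
  exact: (leq_bigmax (Ordinal lt_rq)).
have yE : z (i + m * q) (z r' (z k y)) = y by rewrite -zactD -rE -e zactK.
rewrite -{2}yE; apply: joined_zact gA _ _ _ _ _.
have [_ wc _ _ _] := axA.
by have [|//|/gdistP[]] := wc (z r' (z k y)) x; first exact/svert_zact.
Qed.

(* A representative y of [w L], for L a large neighbourhood of S, lies far from
   S, so a short path from y to the line avoids S. *)
Lemma end_contains_line S w i : finite_set S -> is_end A w ->
  (forall y, line i y -> ~ S y) ->
  w S = [set y | reachable (sadj (del A S)) (z i x) y].
Proof.
move=> fS [compw decw] iS; have [D DP] := line_cobounded.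
have [_ _ lfA _ _] := axA.
pose L := S `|` \bigcup_(n in `I_D.+1)
  [set y | exists2 u, S u & joined (sadj A) n u y].
have fL : finite_set L.
  rewrite finite_setU; split=> //; apply: bigcup_finite => // n _.
  exact: finite_sphere.
have [y [Ay nLy] wLy] := compw L fL.
have wSy : w S y.
  by apply: (decw S L fS fL (@subsetUl _ _ _)); rewrite wLy; exact: reachable_refl.
have [v _ wSE] := compw S fS; rewrite wSE in wSy *.
have [u iu [n le_nD [r [yr lr sr]]]] := DP i y Ay.
have yu : reachable (sadj (del A S)) y u.
  rewrite -lr; exists (size r), r; split=> //; apply: path_del => // s sr' Ss.
  have [m le_m ys] := joined_mem yr sr'.
  apply: nLy; right; exists m.
    by rewrite /= ltnS (leq_trans le_m) // sr.
  by exists s => //; apply: joined_sym ys; exact: sadj_sym.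
have vz : reachable (sadj (del A S)) v (z i x).
  apply: reachable_trans wSy (reachable_trans yu _).
  by apply/reachable_sym/line_connected; first exact: sadj_sym.
apply/seteqP; split=> t /=; last exact: reachable_trans.
by apply: reachable_trans (reachable_sym _ vz); exact: sadj_sym.
Qed.

(** If [S] missed a line, both ends would choose the component of that line in the complement of
    [S]. Points of [S] picked on the [q] disjoint lines are distinct. *)
Lemma end_separating_ge S : end_separating A S -> `I_q #<= S.
Proof.
move=> [fS _ [w1 [w2 [e1 e2 w12]]]].
have ex (i : nat) : exists y, line i y /\ S y.
  apply: contrapT => nex; apply: w12.
  have iS y : line i y -> ~ S y by move=> iy Sy; apply: nex; exists y.
  by rewrite (end_contains_line fS e1 iS) (end_contains_line fS e2 iS).
have [f fP] := choice ex.
have inj_f : {in `I_q &, injective f}.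
  move=> i j /set_mem /= iq /set_mem /= jq fij.
  have [li _] := fP i; have [lj _] := fP j; rewrite -fij in lj.
  exact: line_disjoint iq jq li lj.
have := inj_card_eq inj_f; rewrite card_eq_le => /andP[_ le_f].
by apply: card_le_trans le_f (subset_card_le _) => _ [i _ <-]; case: (fP i).
Qed.

End Lines.
End AxialSubgraph.

(** * Rationality and the bound on the denominator *)

Lemma axial_tau (R : realType) (G : groupType) (X : graph)
    (a : simplicial_action G X) (g : G) (A : subgraph X) :
  loxodromic R a g -> axial a g A ->
  exists p q : nat, [/\ (0 < q)%N, tau R a g = p%:R / q%:R &
    forall w, has_width A w -> (q <= w)%N].
Proof.
move=> lox axA; have [x [p [q [C q0 pE]]]] := minimal_cycle lox axA.
exists (size p), q; split=> //; first by rewrite pE mulfK // pnatr_eq0 -lt0n.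
move=> w [[S sepS Sw] _]; rewrite -card_le_II.
apply: card_le_trans (end_separating_ge lox axA C q0 sepS) _.
by move: Sw; rewrite card_eq_le => /andP[].
Qed.

Theorem theorem2 (R : realType) (G : groupType) (X : graph) (delta : R)
    (a : simplicial_action G X) (hX : hyperbolic delta X) :
  (finiteness_property R a ->
     forall t : R, Spec R a t -> exists q : rat, t = ratr q) /\
  (forall kappa : nat, (1 <= kappa)%N -> kappa_finiteness_property R a kappa ->
     forall t : R, Spec R a t ->
     exists p q : int, [/\ 1 <= q, q <= kappa%:Z & t = p%:~R / q%:~R]).
Proof.
(* As [tau] is nonnegative, the other elements only contribute 0, written 0/1 in the second part. *)
have tau0 g : ~ loxodromic R a g -> tau R a g = 0.
  by move=> /negP; rewrite /loxodromic lt0r tau_ge0 andbT negbK => /eqP.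
split=> [fin|kappa kappa1 fin] t [g _ <-];
    have [lox|/tau0 ->] := pselect (loxodromic R a g).
- have [A axA] := fin g lox.
  have [p [q [_ -> _]]] := axial_tau lox axA.
  by exists (p%:R / q%:R); rewrite fmorph_div /= !ratr_nat.
- by exists 0; rewrite rmorph0.
- have [A axA [w wA le_w]] := fin g lox.
  have [p [q [q0 -> /(_ w wA) le_q]]] := axial_tau lox axA.
  by exists p, q; split=> //; rewrite lez_nat (leq_trans le_q).
- by exists 0, 1; rewrite mul0r.
Qed.
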